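(* Let $\mathcal{A}, \mathcal{B}, \mathcal{C} \in \mathbb{R}^{n \times n \times p}$ be T-positive definite tensors. Then the Tensor Bures--Wasserstein distance $d_{\mathrm{TBW}}$ satisfies: 1. (Non-negativity) $d_{\mathrm{TBW}}(\mathcal{A}, \mathcal{B}) \geq 0$, with equality if and only if $\mathcal{A} = \mathcal{B}$. 2. (Symmetry) $d_{\mathrm{TBW}}(\mathcal{A}, \mathcal{B}) = d_{\mathrm{TBW}}(\mathcal{B}, \mathcal{A})$. 3. (Triangle inequality) $d_{\mathrm{TBW}}(\mathcal{A}, \mathcal{C}) \leq d_{\mathrm{TBW}}(\mathcal{A}, \mathcal{B}) + d_{\mathrm{TBW}}(\mathcal{B}, \mathcal{C})$. Consequently, $d_{\mathrm{TBW}}$ is a metric on the cone of T-positive definite tensors in $\mathbb{R}^{n \times n \times p}$.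
   Context: For a third-order tensor $\mathcal{A} \in \mathbb{R}^{n \times n \times p}$ with frontal slices $A^{(k)} = \mathcal{A}(:,:,k) \in \mathbb{R}^{n\times n}$, $k=1,\dots,p$, its Fourier slices are the frontal slices of the discrete Fourier transform of $\mathcal{A}$ along the third mode: $\hat{A}^{(i)} = \sum_{k=1}^p e^{-2\pi \mathrm{i}(i-1)(k-1)/p} A^{(k)} \in \mathbb{C}^{n\times n}$, $i=1,\dots,p$. $\mathcal{A} \in \mathbb{R}^{n\times n\times p}$ is T-positive definite if every Fourier slice $\hat{A}^{(i)}$, $i=1,\dots,p$, is a Hermitian positive definite matrix. For Hermitian positive definite matrices $A, B \in \mathbb{C}^{n\times n}$, the classical Bures--Wasserstein distance is $$d_{\mathrm{BW}}(A, B) = \left[\operatorname{tr}(A) + \operatorname{tr}(B) - 2\,\operatorname{tr}\!\left(\bigl(A^{1/2}\,B\,A^{1/2}\bigr)^{1/2}\right)\right]^{1/2},$$ where $M^{1/2}$ is the principal (Hermitian positive definite) square root of a Hermitian positive definite matrix $M$. For T-positive definite tensors $\mathcal{A}, \mathcal{B} \in \mathbb{R}^{n\times n\times p}$ with Fourier slices $\hat{A}^{(i)}, \hat{B}^{(i)}$, the Tensor Bures--Wasserstein (TBW) distance is $$d_{\mathrm{TBW}}(\mathcal{A}, \mathcal{B}) := \left( \sum_{i=1}^{p} d_{\mathrm{BW}}^{2}\bigl(\hat{A}^{(i)}, \hat{B}^{(i)}\bigr) \right)^{1/2}.$$ *)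

(* Defs.v *)
From mathcomp Require Import all_boot all_order all_algebra.
From mathcomp Require Import all_classical all_reals trigo.
From mathcomp Require Import complex.

Set Implicit Arguments.
Unset Strict Implicit.
Unset Printing Implicit Defensive.

Import Order.TTheory GRing.Theory Num.Theory Num.Def.

Local Open Scope classical_set_scope.
Local Open Scope ring_scope.
Local Open Scope sesquilinear_scope.

Definition hpdmx (C : numClosedFieldType) (n : nat) (M : 'M[C]_n) : Prop :=
  M \is hermsymmx /\
  forall x : 'cV[C]_n, x != 0 -> 0 < (x^t* *m M *m x) 0 0.

(* The value 0 is returned only when M has no Hermitian positive definite
   square root; if M is Hermitian positive definite then such a root exists
   and is unique, see [hpdmx_sqrt_exists] and [hpdmx_sqrt_unique]. *)
Definition sqrtmx (C : numClosedFieldType) (n : nat) (M : 'M[C]_n) : 'M[C]_n :=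
  xget 0 [set X : 'M[C]_n | hpdmx X /\ X *m X = M].

(* Distances are elements of the closed field C: no real part is taken and
   nothing is truncated, and in the (partial) order of C the assertion
   0 <= d means that d is a nonnegative real number. For z >= 0, [sqrtC z] is
   the usual nonnegative square root. *)
Definition dBW (C : numClosedFieldType) (n : nat) (A B : 'M[C]_n) : C :=
  sqrtC (\tr A + \tr B - 2 * \tr (sqrtmx (sqrtmx A *m B *m sqrtmx A))).

(* Real n x n x p tensors, given by their p frontal slices. *)
Notation tensor3 R n p := {ffun 'I_p -> 'M[R]_n}.

Definition expi (R : realType) (t : R) : R[i] := (cos t +i* sin t)%C.

(* Ordinals start at 0, so i and k stand for i - 1 and k - 1 when slices are
   numbered from 1 to p. *)
Definition fourier_slice (R : realType) (n p : nat) (A : tensor3 R n p)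
    (i : 'I_p) : 'M[R[i]]_n :=
  \sum_(k < p) expi (- (2 * pi * i%:R * k%:R / p%:R))
                 *: map_mx (real_complex R) (A k).

Definition Tposdef (R : realType) (n p : nat) : set (tensor3 R n p) :=
  [set A | forall i : 'I_p, hpdmx (fourier_slice A i)].

Definition dTBW (R : realType) (n p : nat) (A B : tensor3 R n p) : R[i] :=
  sqrtC (\sum_(i < p) dBW (fourier_slice A i) (fourier_slice B i) ^+ 2).

Definition is_metric_on (K : numDomainType) (T : Type) (D : set T)
    (d : T -> T -> K) : Prop :=
  [/\ (forall x y, D x -> D y -> 0 <= d x y),
      (forall x y, D x -> D y -> d x y = 0 <-> x = y),
      (forall x y, D x -> D y -> d x y = d y x)
    & (forall x y z, D x -> D y -> D z -> d x z <= d x y + d y z)].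

Lemma hpdmx_sqrt_exists (C : numClosedFieldType) (n : nat) (M : 'M[C]_n) :
  hpdmx M -> exists2 X : 'M[C]_n, hpdmx X & X *m X = M.
Proof.
move=> [Mh Mp].
have /hermitian_normalmx /orthomx_spectralP eM := Mh.
have Pu := spectral_unitarymx M; have PU := spectral_unit M.
rewrite (invmx_unitary Pu) in eM.
set P := spectralmx M in eM Pu PU; set d := spectral_diag M in eM.
have PPt : P *m P^t* = 1%:M by apply/unitarymxP.
have PtP : P^t* *m P = 1%:M by apply: mulmx1C.
have d_gt0 i : 0 < d 0 i.
  pose e : 'cV[C]_n := delta_mx i 0.
  have x0 : P^t* *m e != 0.
    apply/eqP => /(congr1 (mulmx P)); rewrite mulmxA PPt mul1mx mulmx0.
    by move=> /matrixP/(_ i 0)/eqP; rewrite !mxE !eqxx oner_eq0.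
  have := Mp _ x0; rewrite {1}eM trmx_mul map_mxM /= trmxCK.
  rewrite !mulmxA -(mulmxA _ P) PPt mulmx1 -(mulmxA _ P) PPt mulmx1.
  rewrite mul_mx_diag mxE (bigD1 i)//= big1 ?addr0; last first.
    by move=> j ji; rewrite !mxE (negPf ji) mulr0.
  by rewrite !mxE !eqxx /= conjC1 mul1r mulr1.
pose s : 'rV[C]_n := \row_j sqrtC (d 0 j).
have s_gt0 i : 0 < s 0 i by rewrite mxE sqrtC_gt0.
exists (P^t* *m diag_mx s *m P); last first.
  rewrite !mulmxA -(mulmxA _ P) PPt mulmx1 -(mulmxA (P^t*) (diag_mx s)).
  rewrite mulmx_diag [RHS]eM; congr (_ *m diag_mx _ *m _).
  by apply/rowP => j; rewrite !mxE -expr2 sqrtCK.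
split.
  apply/is_hermitianmxP; rewrite expr0 scale1r !trmx_mul !map_mxM /= trmxCK.
  rewrite mulmxA tr_diag_mx; congr (_ *m _ *m _).
  apply/matrixP => i j; rewrite !mxE rmorphMn /= conj_Creal //.
  by rewrite ger0_real ?sqrtC_ge0 // ltW.
move=> x x0; set y := P *m x.
have y0 : y != 0.
  by apply: contra_neq x0 => y0; rewrite -[x]mul1mx -PtP -mulmxA -/y y0 mulmx0.
have -> : x^t* *m (P^t* *m diag_mx s *m P) *m x = y^t* *m diag_mx s *m y.
  by rewrite /y trmx_mul map_mxM !mulmxA.
clearbody s y; rewrite mul_mx_diag mxE.
have ty j : 0 <= (\matrix_(i, k) ((y^t*) i k * s 0 k)) 0 j * y j 0.
  by rewrite !mxE mulrAC mulr_ge0 ?(ltW (s_gt0 _)) // mulrC -normCK exprn_ge0.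
rewrite lt_def sumr_ge0 ?andbT; last by move=> j _; exact: ty.
apply: contra_neq y0 => /eqP; rewrite psumr_eq0; last by move=> j _; exact: ty.
move=> /allP y0; apply/colP => j; have := y0 j (mem_index_enum _).
rewrite !mxE mulrAC !mulf_eq0 (gt_eqF (s_gt0 _)) orbF conjC_eq0 orbb.
by move=> /eqP.
Qed.

Lemma hpdmx_sqrt_unique (C : numClosedFieldType) (n : nat) (X Y : 'M[C]_n) :
  hpdmx X -> hpdmx Y -> X *m X = Y *m Y -> X = Y.
Proof.
move=> [Xh Xp] [Yh Yp] eXY; apply/eqP; rewrite -subr_eq0; set D := X - Y.
have adj M : M \is hermsymmx -> M^t* = M :> 'M[C]_n.
  by move=> /is_hermitianmxP; rewrite expr0 scale1r => {2}->.
have Dh : D^t* = D by rewrite /D linearB /= map_mxB !adj.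
have e0 : \tr (D *m X *m D) + \tr (D *m Y *m D) = 0.
  have XDY : X *m D + D *m Y = 0.
    by rewrite /D mulmxBr mulmxBl eXY addrC subrKA subrr.
  rewrite -mulmxA (mxtrace_mulC (D *m Y)) -linearD -mulmxDr /=.
  by rewrite XDY mulmx0 linear0.
have tE M : \tr (D *m M *m D) = \sum_j ((col j D)^t* *m M *m col j D) 0 0.
  apply: eq_bigr => j _.
  have -> : (col j D)^t* = row j D.
    by rewrite -[in RHS]Dh; apply/rowP => k; rewrite !mxE.
  rewrite -row_mul !mxE; apply: eq_bigr => k _.
  by rewrite [row _ _ _ _]mxE [col _ _ _ _]mxE.
have pos M : hpdmx M -> forall x : 'cV[C]_n, 0 <= (x^t* *m M *m x) 0 0.
  move=> [_ Mp] x; have [->|/Mp/ltW//] := eqVneq x 0.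
  by rewrite mulmx0 mxE.
apply/negP => /negP D0.
have [j Dj] : exists j, col j D != 0.
  apply/existsP; apply: contraNT D0 => /existsPn D0; apply/eqP/matrixP => i j.
  have /negPn/eqP/colP/(_ i) := D0 j.
  by rewrite !mxE.
have : 0 < \tr (D *m X *m D) + \tr (D *m Y *m D).
  apply: ltr_pwDl; last by rewrite tE sumr_ge0 // => k _; exact: pos.
  rewrite tE (bigD1 j) //= ltr_pwDl ?Xp // sumr_ge0 // => k _.
  exact: pos.
by rewrite e0 ltxx.
Qed.

(* Main.v *)
Require Import Defs.
From mathcomp Require Import all_boot all_order all_algebra.
From mathcomp Require Import all_classical all_reals trigo.
From mathcomp Require Import complex.
From mathcomp Require Import ring lra.

(** For Hermitian positive definite matrices the Bures-Wasserstein distance is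
    a quotient of the Frobenius distance: [dBW A B] is the minimum of
    [fnorm (X - Y)] over the factorizations [A = X X'], [B = Y Y'] (a prime
    denotes the adjoint), and the minimum is already attained for an arbitrary
    given factor of [A].

    The optimal choice comes from the transport map [S], the Hermitian positive
    definite solution of [S A S = B] ([transport_exists]). As the square root
    of [A^(1/2) B A^(1/2)] is [A^(1/2) S A^(1/2)], its trace is [tr (S A)], and
    expanding the square gives [dBW A B = fnorm (X - S X)] for every [X] with
    [X X' = A] ([dBW_fnorm_exists]). The inequality
    [dBW A B <= fnorm (X - Y)] for arbitrary factors ([dBW_le_fnorm]) amounts
    to [tr (X Y') + tr (Y X') <= 2 tr (S A)], which is the nonnegativity of
    the squared norm of [S^(1/2) X - S^(-1/2) Y].

    Separation and symmetry are immediate from these two facts. For the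
    triangle inequality one fixes a factor of the middle matrix, takes optimal
    factors of the two outer ones, and uses the triangle inequality of the
    Frobenius norm.

    The tensor distance is the l2 combination of the distances between Fourier
    slices, so Minkowski's inequality ([sqrtC_sum_sqr_triangle]) carries the
    metric properties over. Separation of tensors moreover needs the
    injectivity of the Fourier transform ([fourier_slice_inj]), since vanishing
    of the distance only says that the slices agree. *)

Set Implicit Arguments.
Unset Strict Implicit.
Unset Printing Implicit Defensive.

Import Order.TTheory GRing.Theory Num.Theory.
Local Open Scope ring_scope.
Local Open Scope sesquilinear_scope.

(** * Hermitian positive definite matrices *)

Lemma trmxC_mul (C : numClosedFieldType) (m n r : nat)
    (X : 'M[C]_(m, n)) (Y : 'M[C]_(n, r)) : (X *m Y)^t* = Y^t* *m X^t*.
Proof. by rewrite trmx_mul map_mxM. Qed.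

Lemma trmxCB (C : numClosedFieldType) (m n : nat) (X Y : 'M[C]_(m, n)) :
  (X - Y)^t* = X^t* - Y^t*.
Proof. by rewrite linearB /= map_mxB. Qed.

Lemma mxtraceB (V : zmodType) (n : nat) (X Y : 'M[V]_n) :
  \tr (X - Y) = \tr X - \tr Y.
Proof. exact: raddfB. Qed.

Lemma hpdmx_adj (C : numClosedFieldType) (n : nat) (M : 'M[C]_n) :
  hpdmx M -> M^t* = M.
Proof. by move=> [/is_hermitianmxP + _]; rewrite expr0 scale1r => {2}->. Qed.

Lemma hpdmx_unit (C : numClosedFieldType) (n : nat) (M : 'M[C]_n) :
  hpdmx M -> M \in unitmx.
Proof.
move=> [_ Mp]; rewrite -row_free_unit -kermx_eq0; apply/negPn/negP.
move=> /rowV0Pn[v /sub_kermxP vM v0].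
have : v^t* != 0.
  apply: contra_neq v0 => v0.
  by rewrite -[v]trmxCK v0 trmx0 map_mx0.
by move=> /Mp; rewrite trmxCK vM mul0mx mxE ltxx.
Qed.

Lemma hpdmx_congr (C : numClosedFieldType) (n : nat) (M X : 'M[C]_n) :
  hpdmx M -> X \in unitmx -> hpdmx (X^t* *m M *m X).
Proof.
move=> Mh Xu; split.
  apply/is_hermitianmxP; rewrite expr0 scale1r !trmxC_mul trmxCK.
  by rewrite (hpdmx_adj Mh) mulmxA.
move=> x x0.
have Xx : X *m x != 0.
  by apply: contra_neq x0 => Xx0; rewrite -[x](mulKmx Xu) Xx0 mulmx0.
by have := Mh.2 _ Xx; rewrite trmxC_mul !mulmxA.
Qed.

Lemma hpdmx_sandwich (C : numClosedFieldType) (n : nat) (M X : 'M[C]_n) :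
  hpdmx M -> hpdmx X -> hpdmx (X *m M *m X).
Proof.
move=> Mh Xh; rewrite -{1}(hpdmx_adj Xh).
by apply: hpdmx_congr => //; exact: hpdmx_unit.
Qed.

Lemma hpdmx_inv (C : numClosedFieldType) (n : nat) (M : 'M[C]_n) :
  hpdmx M -> hpdmx (invmx M).
Proof.
move=> Mh; have Mu := hpdmx_unit Mh.
have MiM : (invmx M)^t* *m M = 1%:M.
  by rewrite -{2}(hpdmx_adj Mh) -trmxC_mul mulmxV // trmx1 map_mx1.
have := hpdmx_congr (X := invmx M) Mh.
by rewrite unitmx_inv MiM mul1mx; apply.
Qed.

Lemma sqrtmx_unique (C : numClosedFieldType) (n : nat) (M X : 'M[C]_n) :
  hpdmx X -> X *m X = M -> sqrtmx M = X.
Proof.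
move=> Xh XX; rewrite /sqrtmx; case: xgetP => [Y _ [Yh YY]|/(_ X)[]//].
by apply: hpdmx_sqrt_unique => //; rewrite YY.
Qed.

Lemma sqrtmxP (C : numClosedFieldType) (n : nat) (M : 'M[C]_n) :
  hpdmx M -> hpdmx (sqrtmx M) /\ sqrtmx M *m sqrtmx M = M.
Proof.
by move=> /hpdmx_sqrt_exists[X Xh XX]; rewrite (sqrtmx_unique Xh XX).
Qed.

Lemma hpdmx_factor (C : numClosedFieldType) (n : nat) (M : 'M[C]_n) :
  hpdmx M -> exists X : 'M[C]_n, X *m X^t* = M.
Proof.
by move=> /sqrtmxP[Xh XX]; exists (sqrtmx M); rewrite (hpdmx_adj Xh).
Qed.

(** * Euclidean and Frobenius norms *)

(** The Frobenius norm, as an element of the closed field. *)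
Definition fnorm (C : numClosedFieldType) (m n : nat) (X : 'M[C]_(m, n)) : C :=
  sqrtC (\tr (X *m X^t*)).

Lemma mxtrace_adjE (C : numClosedFieldType) (m n : nat)
    (X : 'M[C]_(m, n)) :
  \tr (X *m X^t*) = \sum_i \sum_j `|X i j| ^+ 2.
Proof.
apply: eq_bigr => i _; rewrite mxE; apply: eq_bigr => j _.
by rewrite !mxE normCK.
Qed.

Lemma mxtrace_adj_ge0 (C : numClosedFieldType) (m n : nat)
    (X : 'M[C]_(m, n)) : 0 <= \tr (X *m X^t*).
Proof.
rewrite mxtrace_adjE.
by do 2![apply: sumr_ge0 => ? _]; rewrite exprn_ge0.
Qed.

Lemma fnorm_ge0 (C : numClosedFieldType) (m n : nat) (X : 'M[C]_(m, n)) :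
  0 <= fnorm X.
Proof. by rewrite sqrtC_ge0 mxtrace_adj_ge0. Qed.

Lemma fnorm_eq0 (C : numClosedFieldType) (m n : nat) (X : 'M[C]_(m, n)) :
  fnorm X = 0 -> X = 0.
Proof.
move=> /eqP; rewrite sqrtC_eq0 mxtrace_adjE => X0.
apply/matrixP => i j; rewrite mxE; apply/eqP.
have sq k l : 0 <= `|X k l| ^+ 2 by rewrite exprn_ge0.
move: X0; rewrite psumr_eq0; last by move=> k _; exact: sumr_ge0.
move=> /allP/(_ i (mem_index_enum _)); rewrite psumr_eq0 //.
by move=> /allP/(_ j (mem_index_enum _)); rewrite sqrf_eq0 normr_eq0.
Qed.

Lemma fnormN (C : numClosedFieldType) (m n : nat) (X : 'M[C]_(m, n)) :
  fnorm (- X) = fnorm X.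
Proof. by rewrite /fnorm linearN /= map_mxN mulmxN mulNmx opprK. Qed.

Lemma fnorm_mxvec (C : numClosedFieldType) (m n : nat) (X : 'M[C]_(m, n)) :
  fnorm X = sqrtC (dotmx (mxvec X) (mxvec X)).
Proof.
rewrite dotmxE /fnorm mxtrace_adjE pair_bigA /= mxE; congr sqrtC.
rewrite (reindex _ (curry_mxvec_bij _ _)) /=; apply: eq_bigr => -[i j] _ /=.
by rewrite !mxE !mxvecE normCK.
Qed.

Lemma fnormD (C : numClosedFieldType) (m n : nat) (X Y : 'M[C]_(m, n)) :
  fnorm (X + Y) <= fnorm X + fnorm Y.
Proof.
rewrite !fnorm_mxvec linearD /=.
exact: (triangle_lerif (@dotmx C (m * n)) (mxvec X) (mxvec Y)).1.
Qed.

(** Minkowski's inequality for finite families of nonnegative numbers. *)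
Lemma sqrtC_sum_sqr_triangle (C : numClosedFieldType) (p : nat)
    (a b c : 'I_p -> C) :
  (forall i, 0 <= a i) -> (forall i, 0 <= b i) -> (forall i, 0 <= c i) ->
  (forall i, c i <= a i + b i) ->
  sqrtC (\sum_i c i ^+ 2) <=
    sqrtC (\sum_i a i ^+ 2) + sqrtC (\sum_i b i ^+ 2).
Proof.
move=> a0 b0 c0 cab.
have E (f : 'I_p -> C) : (forall i, 0 <= f i) ->
    sqrtC (\sum_i f i ^+ 2) = fnorm (\row_i f i).
  move=> f0; rewrite /fnorm mxtrace_adjE big_ord1; congr sqrtC.
  by apply: eq_bigr => i _; rewrite mxE ger0_norm.
apply: (@le_trans _ _ (sqrtC (\sum_i (a i + b i) ^+ 2))).
  rewrite ler_sqrtC ?nnegrE ?sumr_ge0 // => [|i _|i _].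
  - apply: ler_sum => i _; rewrite lerXn2r ?nnegrE ?addr_ge0 //.
  - by rewrite exprn_ge0.
  - by rewrite exprn_ge0 ?addr_ge0.
rewrite !E // => [|i]; last by rewrite addr_ge0.
have -> : \row_i (a i + b i) = \row_i a i + \row_i b i.
  by apply/rowP => i; rewrite !mxE.
exact: fnormD.
Qed.

(** * The Bures-Wasserstein distance *)

(** The optimal transport map from [A] to [B]: the Hermitian positive definite
    solution of the Riccati equation [S A S = B]. *)
Lemma transport_exists (C : numClosedFieldType) (n : nat) (A B : 'M[C]_n) :
  hpdmx A -> hpdmx B -> exists2 S : 'M[C]_n, hpdmx S & S *m A *m S = B.
Proof.
move=> Ah Bh; have [Ph PP] := sqrtmxP Ah; set P := sqrtmx A in Ph PP.
have [Qh QQ] := sqrtmxP (hpdmx_sandwich Bh Ph).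
set Q := sqrtmx _ in Qh QQ.
have Pu := hpdmx_unit Ph.
exists (invmx P *m Q *m invmx P); first exact: hpdmx_sandwich (hpdmx_inv Ph).
rewrite -PP !mulmxA (mulmxKV Pu) (mulmxK Pu) -(mulmxA _ Q Q) QQ.
by rewrite !mulmxA (mulVmx Pu) mul1mx (mulmxK Pu).
Qed.

(** The square root in the definition of the distance is [P S P], where [P] is
    the square root of [A]. *)
Lemma dBW_transport (C : numClosedFieldType) (n : nat) (A S : 'M[C]_n) :
  hpdmx A -> hpdmx S ->
  dBW A (S *m A *m S) =
    sqrtC (\tr A + \tr (S *m A *m S) - 2 * \tr (S *m A)).
Proof.
move=> Ah Sh; have [Ph PP] := sqrtmxP Ah; rewrite /dBW.
set P := sqrtmx A in Ph PP *.
rewrite (sqrtmx_unique (hpdmx_sandwich Sh Ph)).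
  by rewrite [\tr (P *m S *m P)]mxtrace_mulC mulmxA PP (mxtrace_mulC A).
by rewrite -PP !mulmxA.
Qed.

Lemma mxtrace_transport (C : numClosedFieldType) (n : nat)
    (A S X : 'M[C]_n) :
  hpdmx S -> X *m X^t* = A ->
  \tr A + \tr (S *m A *m S) - 2 * \tr (S *m A) =
    \tr ((X - S *m X) *m (X - S *m X)^t*).
Proof.
move=> Sh XX; rewrite trmxCB trmxC_mul (hpdmx_adj Sh) mulmxBl !mulmxBr !mulmxA.
rewrite XX -[S *m X *m X^t*]mulmxA XX !mxtraceB (mxtrace_mulC A S).
by ring.
Qed.

Lemma dBW_fnorm_transport (C : numClosedFieldType) (n : nat)
    (A S X : 'M[C]_n) :
  hpdmx A -> hpdmx S -> X *m X^t* = A ->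
  dBW A (S *m A *m S) = fnorm (X - S *m X).
Proof.
by move=> Ah Sh XX; rewrite dBW_transport // (mxtrace_transport Sh XX).
Qed.

(** The lower half of the variational description of the distance. *)
Lemma dBW_le_fnorm (C : numClosedFieldType) (n : nat) (A B X Y : 'M[C]_n) :
  hpdmx A -> hpdmx B -> X *m X^t* = A -> Y *m Y^t* = B ->
  dBW A B <= fnorm (X - Y).
Proof.
move=> Ah Bh XX YY; have [S Sh SAS] := transport_exists Ah Bh.
have [Vh VV] := sqrtmxP Sh; set V := sqrtmx S in Vh VV.
have Vu := hpdmx_unit Vh; have Wh := hpdmx_inv Vh.
rewrite -{1}SAS (dBW_fnorm_transport Ah Sh XX) /fnorm.
rewrite ler_sqrtC ?nnegrE ?mxtrace_adj_ge0 // -(mxtrace_transport Sh XX) SAS.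
(* With [V] the square root of the transport map, the difference of the two
   sides is the squared norm below. *)
have := mxtrace_adj_ge0 (V *m X - invmx V *m Y).
rewrite !trmxCB !trmxC_mul (hpdmx_adj Vh) (hpdmx_adj Wh).
rewrite !(mulmxBl, mulmxBr) !mxtraceB !mulmxA XX YY.
have -> : \tr (V *m X *m X^t* *m V) = \tr (S *m A).
  by rewrite mxtrace_mulC !mulmxA VV -mulmxA XX.
have -> : \tr (V *m X *m Y^t* *m invmx V) = \tr (X *m Y^t*).
  by rewrite mxtrace_mulC !mulmxA mulVmx // mul1mx.
have -> : \tr (invmx V *m Y *m X^t* *m V) = \tr (Y *m X^t*).
  by rewrite mxtrace_mulC !mulmxA mulmxV // mul1mx.
have -> : \tr (invmx V *m Y *m Y^t* *m invmx V) = \tr (S *m A).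
  rewrite -(mulmxA _ Y) YY -SAS -VV !mulmxA mulVmx // mul1mx (mulmxK Vu).
  by rewrite mxtrace_mulC !mulmxA.
rewrite -subr_ge0 => h; rewrite -subr_ge0; apply: le_trans h _.
by rewrite le_eqVlt; apply/orP; left; apply/eqP; ring.
Qed.

(** The bound of [dBW_le_fnorm] is attained, whatever factor of [A] is given. *)
Lemma dBW_fnorm_exists (C : numClosedFieldType) (n : nat) (A B X : 'M[C]_n) :
  hpdmx A -> hpdmx B -> X *m X^t* = A ->
  exists2 Y : 'M[C]_n, Y *m Y^t* = B & dBW A B = fnorm (X - Y).
Proof.
move=> Ah Bh XX; have [S Sh SAS] := transport_exists Ah Bh.
exists (S *m X); last by rewrite -SAS; exact: dBW_fnorm_transport.
by rewrite trmxC_mul (hpdmx_adj Sh) !mulmxA -(mulmxA S X) XX.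
Qed.

Lemma dBW_ge0 (C : numClosedFieldType) (n : nat) (A B : 'M[C]_n) :
  hpdmx A -> hpdmx B -> 0 <= dBW A B.
Proof.
move=> Ah Bh; have [X XX] := hpdmx_factor Ah.
by have [Y _ ->] := dBW_fnorm_exists Ah Bh XX; exact: fnorm_ge0.
Qed.

Lemma dBW_eq0 (C : numClosedFieldType) (n : nat) (A B : 'M[C]_n) :
  hpdmx A -> hpdmx B -> dBW A B = 0 <-> A = B.
Proof.
move=> Ah Bh; have [X XX] := hpdmx_factor Ah.
split=> [dAB|<-].
  have [Y YY] := dBW_fnorm_exists Ah Bh XX.
  by rewrite dAB => /esym/fnorm_eq0/eqP; rewrite subr_eq0 -YY -XX => /eqP ->.
apply/eqP; rewrite eq_le dBW_ge0 // andbT.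
have := dBW_le_fnorm Ah Ah XX XX.
by rewrite subrr /fnorm mul0mx linear0 sqrtC0.
Qed.

Lemma dBW_sym (C : numClosedFieldType) (n : nat) (A B : 'M[C]_n) :
  hpdmx A -> hpdmx B -> dBW A B = dBW B A.
Proof.
have le A' B' : hpdmx A' -> hpdmx B' -> dBW A' B' <= dBW B' A' :> C.
  move=> {}Ah {}Bh; have [Y YY] := hpdmx_factor Bh.
  have [X XX ->] := dBW_fnorm_exists Bh Ah YY.
  by rewrite -fnormN opprB; exact: dBW_le_fnorm.
by move=> Ah Bh; apply/le_anti; rewrite !le.
Qed.

Lemma dBW_triangle (C : numClosedFieldType) (n : nat) (A B D : 'M[C]_n) :
  hpdmx A -> hpdmx B -> hpdmx D -> dBW A D <= dBW A B + dBW B D.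
Proof.
move=> Ah Bh Dh; rewrite (dBW_sym Ah Bh); have [Y YY] := hpdmx_factor Bh.
have [X XX ->] := dBW_fnorm_exists Bh Ah YY.
have [Z ZZ ->] := dBW_fnorm_exists Bh Dh YY.
apply: le_trans (dBW_le_fnorm Ah Dh XX ZZ) _.
by rewrite -[X - Z](subrKA Y) -(fnormN (_ - X)) opprB; exact: fnormD.
Qed.

(** The l2 combination of the distances between the members of two families of
    matrices; the tensor distance is this one on the Fourier slices. *)
Definition dBW_family (C : numClosedFieldType) (n p : nat)
    (A B : 'I_p -> 'M[C]_n) : C := sqrtC (\sum_(i < p) dBW (A i) (B i) ^+ 2).

Lemma dBW_family_ge0 (C : numClosedFieldType) (n p : nat)
    (A B : 'I_p -> 'M[C]_n) :
  (forall i, hpdmx (A i)) -> (forall i, hpdmx (B i)) -> 0 <= dBW_family A B.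
Proof.
move=> Ah Bh; rewrite sqrtC_ge0; apply: sumr_ge0 => i _.
by rewrite exprn_ge0 ?dBW_ge0.
Qed.

Lemma dBW_family_eq0 (C : numClosedFieldType) (n p : nat)
    (A B : 'I_p -> 'M[C]_n) :
  (forall i, hpdmx (A i)) -> (forall i, hpdmx (B i)) ->
  dBW_family A B = 0 <-> A =1 B.
Proof.
move=> Ah Bh; split=> [/eqP|AB].
  rewrite sqrtC_eq0 psumr_eq0 => [/allP AB i|i _]; last first.
    by rewrite exprn_ge0 ?dBW_ge0.
  apply/(dBW_eq0 (Ah i) (Bh i)).
  by have := AB i (mem_index_enum _); rewrite sqrf_eq0 => /eqP.
rewrite /dBW_family big1 ?sqrtC0 // => i _.
by rewrite ((dBW_eq0 (Ah i) (Bh i)).2 (AB i)) expr0n.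
Qed.

Lemma dBW_family_sym (C : numClosedFieldType) (n p : nat)
    (A B : 'I_p -> 'M[C]_n) :
  (forall i, hpdmx (A i)) -> (forall i, hpdmx (B i)) ->
  dBW_family A B = dBW_family B A.
Proof.
by move=> Ah Bh; congr sqrtC; apply: eq_bigr => i _; rewrite dBW_sym.
Qed.

Lemma dBW_family_triangle (C : numClosedFieldType) (n p : nat)
    (A B D : 'I_p -> 'M[C]_n) :
  (forall i, hpdmx (A i)) -> (forall i, hpdmx (B i)) ->
  (forall i, hpdmx (D i)) ->
  dBW_family A D <= dBW_family A B + dBW_family B D.
Proof.
move=> Ah Bh Dh; apply: sqrtC_sum_sqr_triangle => i; try exact: dBW_ge0.
exact: dBW_triangle.
Qed.

(** * The discrete Fourier transform *)

Lemma expiD (R : realType) (s t : R) : expi (s + t) = expi s * expi t.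
Proof.
rewrite /expi cosD sinD; apply/eqP; rewrite eq_complex /= eqxx /=.
by rewrite addrC.
Qed.

Lemma expiMn (R : realType) (t : R) (k : nat) : expi (t * k%:R) = expi t ^+ k.
Proof.
elim: k => [|k IH]; first by rewrite mulr0 /expi cos0 sin0.
by rewrite -natr1 mulrDr mulr1 expiD IH exprSr.
Qed.

(** The real part is [1 - 2 (sin (t / 2))^2], with [t / 2] in the open interval
    from 0 to [pi]. *)
Lemma expi_neq1 (R : realType) (t : R) : 0 < t < pi *+ 2 -> expi t != 1.
Proof.
move=> /andP[t0 tpi]; rewrite /expi eq_complex /= negb_and; apply/orP; left.
have s0 : 0 < sin (t / 2).
  by apply: sin_gt0_pi; rewrite divr_gt0 //= ltr_pdivrMr // mulr_natr.
have -> : t = (t / 2) *+ 2 by field.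
rewrite cos_mulr2n cos2sin2 mulrnBl lt_eqF //.
have : 0 < sin (t / 2) ^+ 2 by rewrite exprn_gt0.
lra.
Qed.

(** The nodes [exp(- 2 pi sqrt(-1) i / p)], for [i < p], of the transform are
    pairwise distinct. *)
Lemma expi_nodes_inj (R : realType) (p : nat) :
  injective (fun i : 'I_p => expi (- (2 * pi * i%:R / p%:R) : R)).
Proof.
have lt_neq (i j : 'I_p) : (i < j)%N ->
    expi (- (2 * pi * i%:R / p%:R) : R) != expi (- (2 * pi * j%:R / p%:R)).
  move=> ij; have p_gt0 : (0 < p)%N by rewrite (leq_ltn_trans _ (ltn_ord i)).
  have : expi (2 * pi * (j - i)%:R / p%:R : R) != 1.
    apply: expi_neq1; rewrite divr_gt0 ?mulr_gt0 ?pi_gt0 ?ltr0n ?subn_gt0 //=.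
    rewrite ltr_pdivrMr ?ltr0n // -[pi *+ 2]mulr_natl.
    rewrite ltr_pM2l ?mulr_gt0 ?pi_gt0 // ltr_nat.
    by rewrite (leq_ltn_trans (leq_subr _ _)).
  (* The quotient of the two nodes is this number different from 1. *)
  move=> /eqP neq1; apply/eqP => e; apply: neq1.
  have -> : 2 * pi * (j - i)%:R / p%:R =
      - (2 * pi * i%:R / p%:R) + 2 * pi * j%:R / p%:R :> R.
    by rewrite natrB 1?ltnW //; field; rewrite pnatr_eq0 -lt0n.
  by rewrite expiD e -expiD addNr /expi cos0 sin0.
move=> i j e; apply: val_inj.
by case: (ltngtP i j) => // /lt_neq; rewrite e eqxx.
Qed.

(** Evaluated at a fixed entry, the Fourier slices are the values at [p]
    distinct nodes of a polynomial of degree less than [p]. *)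
Lemma fourier_slice_inj (R : realType) (n p : nat) (A B : tensor3 R n p) :
  fourier_slice A =1 fourier_slice B -> A = B.
Proof.
move=> AB; apply/ffunP => k; apply/matrixP => a b.
pose w (i : 'I_p) : R[i] := expi (- (2 * pi * i%:R / p%:R)).
pose c (l : nat) : R[i] :=
  oapp (fun l : 'I_p => real_complex R (A l a b - B l a b)) 0 (insub l).
(* The coefficients are the differences of the entries at [(a, b)], extended by
   0 beyond [p]; the polynomial vanishes at the [p] nodes. *)
have q0 : \poly_(l < p) c l = 0.
  apply: (@roots_geq_poly_eq0 _ _ (codom w)).
  - apply/allP => _ /codomP[i ->]; rewrite /root horner_poly; apply/eqP.
    transitivity ((fourier_slice A i - fourier_slice B i) a b); last first.
      by rewrite AB subrr mxE.
    rewrite /fourier_slice !mxE !summxE -sumrB; apply: eq_bigr => l _.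
    rewrite /c valK /= !mxE rmorphB /= mulrC mulrBr /w -expiMn mulNr.
    have -> // : 2 * pi * i%:R * l%:R / p%:R = 2 * pi * i%:R / p%:R * l%:R :> R.
    by ring.
  - by apply/injectiveP; exact: expi_nodes_inj.
  - by rewrite size_codom card_ord size_poly.
have := coef_poly p c k; rewrite q0 coef0 ltn_ord /c valK /= => /esym/eqP.
by rewrite fmorph_eq0 subr_eq0 => /eqP.
Qed.

(** * The tensor distance *)

Lemma dTBW_metric (R : realType) (n p : nat) :
  is_metric_on (@Tposdef R n p) (@dTBW R n p).
Proof.
have dE A B : @dTBW R n p A B = dBW_family (fourier_slice A) (fourier_slice B).
  by [].
split=> [A B Ah Bh|A B Ah Bh|A B Ah Bh|A B D Ah Bh Dh]; rewrite !dE.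
- exact: (dBW_family_ge0 Ah Bh).
- split=> [/(dBW_family_eq0 Ah Bh)/fourier_slice_inj //|AB].
  by apply/(dBW_family_eq0 Ah Bh) => i; rewrite AB.
- exact: (dBW_family_sym Ah Bh).
- exact: (dBW_family_triangle Ah Bh Dh).
Qed.

Unset Implicit Arguments.

Theorem proposition3p2 (R : realType) (n p : nat) :
  (forall A B C : tensor3 R n p, Tposdef A -> Tposdef B -> Tposdef C ->
    [/\ 0 <= dTBW A B /\ (dTBW A B = 0 <-> A = B),
        dTBW A B = dTBW B A
      & dTBW A C <= dTBW A B + dTBW B C])
  /\ is_metric_on (@Tposdef R n p) (@dTBW R n p).
Proof.
have [ge0 eq0 sym tri] := dTBW_metric R n p.
split; last exact: (dTBW_metric R n p).
move=> A B C Ah Bh Ch; split.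
- by split; [exact: (ge0 A B Ah Bh)|exact: (eq0 A B Ah Bh)].
- exact: (sym A B Ah Bh).
- exact: (tri A B C Ah Bh Ch).
Qed.
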